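(* Let $\Upsilon$ be a finite purely relational vocabulary. Let $\mathcal{C}$ be a nonempty pseudo-connected class (closed under isomorphism) of finite $\Upsilon$-structures of bounded degree that is closed under substructures and disjoint unions, and let $S$ be the disjoint union of all members of $\mathcal{C}$ (one representative for each isomorphism class). Then: (1) There is an infinite structure $X$, called an ambient structure for $\mathcal{C}$, such that $X$ is connected, has bounded degree and has the duplicate substructure property, and such that $\mathcal{C}$ is the collection of all structures isomorphic to finite substructures of $X$. (2) An arbitrary first-order $\Upsilon$-sentence $\phi$ is almost surely true for $\mathcal{C}$ (that is, almost surely true for finite substructures of $X$, where $X$ is any ambient structure for $\mathcal{C}$) if and only if $\phi$ holds in $S$.
   Context: Structures are $\Upsilon$-structures. A substructure is the induced substructure on a subset of elements (the empty subset is allowed). The Gaifman graph $[X]$ of a structure $X$ has the elements of $X$ as vertices, with an undirected edge between distinct $x,y$ whenever there are $R\in\Upsilon$ and $z_1,\ldots,z_\ell\in X$ with $R(z_1,\ldots,z_\ell)$ true in $X$ and $x,y\in\{z_1,\ldots,z_\ell\}$. A structure is connected if its Gaifman graph has exactly one connected component; it has bounded degree if the vertex degrees of its Gaifman graph are finite and uniformly bounded. A class of finite structures has bounded degree if there is one bound on the vertex degrees of the Gaifman graphs of all its members. The distance $d(x,y)$ is the length of a shortest path in $[X]$ ($\infty$ if there is none), and $B_n(x)$ is the substructure of $X$ supported by the elements at distance at most $n$ from $x$. Two substructures of $X$ are disjoint if they have no common element and there are no edges of $[X]$ between them. $X$ has the duplicate substructure property if for every finite substructure of $X$ there is an isomorphic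 substructure of $X$ disjoint from it. A class $\mathcal{C}$ of finite structures is pseudo-connected if for every $Y\in\mathcal{C}$ there is an embedding of $Y$ (as an induced substructure) into a connected member of $\mathcal{C}$. For $X$ infinite, connected and of bounded degree, a sentence is almost surely true for finite substructures of $X$ if for every $x\in X$ the fraction of substructures of $B_n(x)$ (i.e. of subsets of its element set) for which the sentence is true approaches $1$ as $n\to\infty$. *)

(* Defs.v *)
From HB Require Import structures.
From mathcomp Require Import all_boot all_order all_algebra finmap.
From mathcomp Require Import all_classical all_reals.
From mathcomp Require Import topology normedtype.
Set Implicit Arguments.
Unset Strict Implicit.
Unset Printing Implicit Defensive.
Import Order.TTheory GRing.Theory Num.Theory.
Import numFieldNormedType.Exports.
Local Open Scope classical_set_scope.

(* Symbols of arity 0 are excluded: a truth value attached to a structure as a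
   whole would not be compatible with disjoint unions. *)
Record vocabulary := Vocabulary {
  symbol :> finType;
  arity : symbol -> nat;
  arity_gt0 : forall R, 0 < arity R
}.

Record structure (V : vocabulary) := Structure {
  carrier :> Type;
  interp : forall R : V, ('I_(arity R) -> carrier) -> Prop
}.
Arguments Structure {V carrier} interp.
Arguments interp {V} s R z.

Section Structures.
Variable V : vocabulary.
Implicit Types X Y Z : structure V.

Definition embeds X Y :=
  exists2 f : X -> Y, injective f &
    forall (R : V) z, interp X R z <-> interp Y R (f \o z).

Definition isomorphic X Y :=
  exists2 f : X -> Y, bijective f &
    forall (R : V) z, interp X R z <-> interp Y R (f \o z).

Definition substructure X (A : set X) : structure V :=
  Structure (fun (R : V) (z : 'I_(arity R) -> A) =>
    interp X R (fun k => val (z k))).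

Definition disjoint_union (I : Type) (F : I -> structure V) : structure V :=
  Structure (fun (R : V) (z : 'I_(arity R) -> {i : I & F i}) =>
    exists i (w : 'I_(arity R) -> F i),
      interp (F i) R w /\ z = (fun k => existT F i (w k))).

Definition edge X (x y : X) :=
  x <> y /\
  exists (R : V) (z : 'I_(arity R) -> X),
    [/\ interp X R z, exists k, z k = x & exists k, z k = y].

Definition has_walk X (x y : X) (n : nat) :=
  exists p : seq X,
    [/\ path (fun a b => `[< edge a b >]) x p, last x p = y & size p = n].

Definition component X (x : X) : set X :=
  [set y | exists n, has_walk x y n].

Definition connected_structure X :=
  exists! K : set X, exists x, K = component x.

Definition degree_bounded_by X (D : nat) :=
  forall x : X, ([set y | edge x y] #<= `I_D)%card.

Definition bounded_degree X := exists D, degree_bounded_by X D.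

(* Walks may repeat vertices, but one of minimal length is a path. *)
Definition distance_eq X (x y : X) (d : nat) :=
  has_walk x y d /\ forall m, has_walk x y m -> d <= m.

Definition gaifman_ball X (n : nat) (x : X) : set X :=
  [set y | exists2 d, distance_eq x y d & d <= n].

Definition disjoint_substructures X (A B : set X) :=
  A `&` B = set0 /\ forall a b, A a -> B b -> ~ edge a b.

Definition duplicate_substructure_property X :=
  forall A : set X, finite_set A ->
    exists2 B : set X,
      isomorphic (substructure A) (substructure B) &
      disjoint_substructures A B.

Section Classes.
Variable C : structure V -> Prop.

Definition iso_closed := forall Y Z, isomorphic Y Z -> C Y -> C Z.

Definition finite_members := forall Y, C Y -> finite_set [set: Y].

Definition substructure_closed :=
  forall Y (A : set Y), C Y -> C (substructure A).

Definition disjoint_union_closed :=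
  forall Y Z, C Y -> C Z ->
    C (disjoint_union (fun b : bool => if b then Y else Z)).

Definition class_bounded_degree :=
  exists D, forall Y, C Y -> degree_bounded_by Y D.

Definition pseudo_connected :=
  forall Y, C Y -> exists Z, [/\ C Z, connected_structure Z & embeds Y Z].

Definition representatives (I : Type) (rep : I -> structure V) :=
  (forall i, C (rep i)) /\ forall Y, C Y -> exists! i, isomorphic Y (rep i).

Definition ambient X :=
  [/\ infinite_set [set: X],
      connected_structure X,
      bounded_degree X,
      duplicate_substructure_property X &
      forall Y, C Y <->
        exists2 A : set X, finite_set A & isomorphic Y (substructure A)].

End Classes.
End Structures.

(* Finite structures are enumerated up to isomorphism by codes on the sets 'I_n,
   so a system of representatives always exists. *)
Lemma representatives_exist (V : vocabulary) (C : structure V -> Prop) :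
  iso_closed C -> finite_members C ->
  exists (I : Type) (rep : I -> structure V), representatives C rep.
Proof.
move=> isoC finC.
pose code := {n : nat & forall R : V, ('I_(arity R) -> 'I_n) -> Prop}.
pose str (c : code) : structure V := Structure (projT2 c).
have iso_sym (X Y : structure V) : isomorphic X Y -> isomorphic Y X.
  move=> [f [g fK gK] fP]; exists g; first by exists f.
  move=> R z; rewrite fP; suff -> : f \o (g \o z) = z by [].
  by apply/funext => k /=; rewrite gK.
have iso_trans (X Y Z : structure V) :
    isomorphic X Y -> isomorphic Y Z -> isomorphic X Z.
  move=> [f bf fP] [g bg gP]; exists (g \o f); first exact: bij_comp.
  by move=> R z; rewrite fP gP.
have has_code (Y : structure V) : C Y -> exists c, isomorphic Y (str c).
  move=> /finC [n YI].
  have /card_bijP[f [g fK gK]] : ([set: Y] #= [set: 'I_n])%card.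
    exact: card_eq_trans YI card_II.
  pose f' (y : Y) : 'I_n := val (f (exist _ y (@mem_set _ setT y I))).
  pose g' (i : 'I_n) : Y := val (g (exist _ i (@mem_set _ setT i I))).
  have f'K : cancel f' g'.
    move=> y; rewrite /f' /g'; set u := exist _ (val _) _.
    have -> : u = f (exist _ y (@mem_set _ setT y I)) by apply/val_inj.
    by rewrite fK.
  have g'K : cancel g' f'.
    move=> i; rewrite /f' /g'; set u := exist _ (val _) _.
    have -> : u = g (exist _ i (@mem_set _ setT i I)) by apply/val_inj.
    by rewrite gK.
  exists (existT _ n (fun R z => interp Y R (g' \o z))).
  exists f'; first by exists g'.
  move=> R z /=; suff -> : g' \o (f' \o z) = z by [].
  by apply/funext => k /=; rewrite f'K.
pose canon (Y : structure V) : code :=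
  xget (existT _ 0 (fun=> fun=> False) : {classic code})
    [set c | isomorphic Y (str c)].
have canonP (Y : structure V) : C Y -> isomorphic Y (str (canon Y)).
  move=> /has_code[c Yc].
  exact: (@xgetI {classic code} _ [set c | isomorphic Y (str c)] c).
have canon_eq (Y Z : structure V) : isomorphic Y Z -> canon Y = canon Z.
  move=> YZ; rewrite /canon.
  suff -> : [set c | isomorphic Y (str c)] = [set c | isomorphic Z (str c)].
    by [].
  apply/seteqP; split=> c /=; last exact: iso_trans.
  by apply: iso_trans; exact: iso_sym.
exists {c : code | C (str c) /\ canon (str c) = c}, (fun i => str (sval i)).
split=> [[c []] //|Y CY].
have Cc : C (str (canon Y)) by apply: isoC (canonP _ CY) CY.
have cc : canon (str (canon Y)) = canon Y.
  exact/esym/canon_eq/canonP.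
exists (exist _ (canon Y) (conj Cc cc)); split; first exact: canonP.
move=> [d [Cd dd]] /= Yd; apply: eq_exist.
by rewrite (canon_eq _ _ Yd).
Qed.

(* First-order formulas with equality whose free variables are among n de
   Bruijn variables. Indexing by n, rather than evaluating under assignments
   nat -> X, gives sentences a truth value in the empty structure. *)
Inductive formula (V : vocabulary) : nat -> Type :=
| Fbot n : formula V n
| Feq n (i j : 'I_n) : formula V n
| Frel n (R : V) (a : 'I_(arity R) -> 'I_n) : formula V n
| Fnot n (f : formula V n) : formula V n
| Fand n (f g : formula V n) : formula V n
| For n (f g : formula V n) : formula V n
| Fimp n (f g : formula V n) : formula V n
| Fall n (f : formula V n.+1) : formula V n
| Fex n (f : formula V n.+1) : formula V n.

Notation sentence V := (formula V 0).

(* Variable 0 is the innermost bound one. *)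
Definition extend (T : Type) n (x : T) (v : 'I_n -> T) : 'I_n.+1 -> T :=
  fun i => oapp v x (unlift ord0 i).

Fixpoint satisfies (V : vocabulary) (X : structure V) n (f : formula V n) :
    ('I_n -> X) -> Prop :=
  match f in formula _ m return ('I_m -> X) -> Prop with
  | Fbot _ => fun=> False
  | Feq _ i j => fun v => v i = v j
  | Frel _ R a => fun v => interp X R (v \o a)
  | Fnot _ g => fun v => ~ satisfies g v
  | Fand _ g h => fun v => satisfies g v /\ satisfies h v
  | For _ g h => fun v => satisfies g v \/ satisfies h v
  | Fimp _ g h => fun v => satisfies g v -> satisfies h v
  | Fall _ g => fun v => forall x, satisfies g (extend x v)
  | Fex _ g => fun v => exists x, satisfies g (extend x v)
  end.

Definition models (V : vocabulary) (X : structure V) (phi : sentence V) :=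
  satisfies phi (fun i : 'I_0 => match notF (ltn_ord i) with end : X).

Section AlmostSure.
Variables (R : realType) (V : vocabulary) (X : structure V).
Local Open Scope ring_scope.

Definition fraction_true (phi : sentence V) (x : X) (n : nat) : R :=
  #|` fset_set [set A : set X |
        A `<=` gaifman_ball n x /\ models (substructure A) phi]|%:R /
  #|` fset_set [set A : set X | A `<=` gaifman_ball n x]|%:R.

Definition almost_surely_true (phi : sentence V) :=
  forall x : X, fraction_true phi x n @[n --> \oo] --> (1 : R).

End AlmostSure.

(* Main.v *)
(** Part (2): write "isolated copy" for an induced copy that is a union of
    Gaifman components. If two structures of bounded degree, all of whose balls
    lie in C, both contain an isolated copy of every small member of C off any
    small set, then Duplicator wins the Ehrenfeucht-Fraisse game between them by
    keeping matched the neighborhoods of the chosen points: a point close to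
    previous ones is answered by the current partial isomorphism, and a far one
    by an isolated copy of its ball. This richness follows from a single isolated
    copy of a suitable W in C (many copies of all small members). S contains one,
    and a random finite substructure of X almost surely does, since X contains
    infinitely many copies of W with disjoint neighborhoods, each of bounded
    size.

    Part (1): X is the union of a chain of connected members of C, each of which
    contains the previous one and the next term of an enumeration of C. For the
    duplicate substructure property, an induced disjoint union in X of many
    copies of A need not be free of Gaifman edges between the copies, because a
    tuple may use further points of X; but A has boundedly many neighbors, so
    some copy avoids them all. *)

From Stdlib Require List.
Require Import Defs.
From mathcomp Require Import all_boot all_order all_algebra finmap.
From mathcomp Require Import all_classical all_reals.
From mathcomp Require Import topology normedtype sequences.
Set Implicit Arguments.
Unset Strict Implicit.
Unset Printing Implicit Defensive.
Import Order.TTheory GRing.Theory Num.Theory.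
Import numFieldNormedType.Exports.
Local Open Scope classical_set_scope.

(** * Sets of bounded size *)

(** A listing, with repetitions and outsiders allowed, stands in for cardinality: it passes easily
    to unions, images and neighborhoods. [List.In] needs no decidable equality on [T]. *)
Definition covered (T : Type) (A : set T) (k : nat) :=
  exists2 l : seq T, size l <= k & forall x, A x -> List.In x l.

Section Covered.
Variables T U : Type.

Lemma covered_le (A B : set T) j k :
  A `<=` B -> j <= k -> covered B j -> covered A k.
Proof.
move=> AB jk [l lj Bl]; exists l => [|x /AB]; first exact: leq_trans jk.
exact: Bl.
Qed.

Lemma coveredU (A B : set T) j k :
  covered A j -> covered B k -> covered (A `|` B) (j + k).
Proof.
move=> [l lj Al] [m mk Bm]; exists (l ++ m).
  by rewrite size_cat leq_add.
by move=> x [/Al|/Bm] xl; apply/List.in_or_app; [left|right].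
Qed.

Lemma covered_bigcup (A : set U) (F : U -> set T) k d :
  covered A k -> (forall x, A x -> covered (F x) d) ->
  covered (\bigcup_(x in A) F x) (k * d).
Proof.
move=> [l lk Al] Fd.
(* The list may contain points outside [A], where [F] has no bound; intersecting with [A] lets the
   induction skip them. *)
suff : covered (\bigcup_(x in A `&` [set x | List.In x l]) F x) (size l * d).
  apply: covered_le; last by rewrite leq_mul2r lk orbT.
  by move=> y [x Ax Fxy]; exists x => //; split=> //; exact: Al.
elim: l {lk Al} => [|x l IH]; first by exists [::] => // y [? []].
have [Ax|nAx] := pselect (A x).
  rewrite /= mulSn; apply: covered_le (leqnn _) (coveredU (Fd x Ax) IH).
  by move=> y [z [Az [->|zl]] Fy]; [left|right; exists z].
rewrite /= mulSn; apply: covered_le (leq_addl _ _) IH.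
by move=> y [z [Az [xz|zl]] Fy]; [move: Az; rewrite -xz|exists z].
Qed.

Lemma covered_image (f : U -> T) (A : set U) k :
  covered A k -> covered (f @` A) k.
Proof.
move=> [l lk Al]; exists (map f l); first by rewrite size_map.
by move=> _ [x /Al xl <-]; exact: List.in_map.
Qed.

Lemma covered_preimage (h : U -> T) (F : set T) k :
  injective h -> covered F k -> covered (h @^-1` F) k.
Proof.
move=> hI [l lk Fl].
suff [m ml hm] : exists2 m, size m <= size l &
    forall u, List.In (h u) l -> List.In u m.
  by exists m; [exact: leq_trans lk|move=> u /Fl /hm].
elim: l {lk Fl} => [|y l [m ml hm]]; first by exists [::].
have [[u <-]|ny] := pselect (exists u, h u = y).
  by exists (u :: m) => // v [/hI ->|/hm]; [left|right].
exists m; first exact: leqW.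
by move=> u [yu|/hm //]; case: ny; exists u.
Qed.

Lemma covered_inj (f : T -> nat) (A : set T) k :
  (forall x, A x -> f x < k) ->
  (forall x y, A x -> A y -> f x = f y -> x = y) -> covered A k.
Proof.
elim: k A => [|k IH] A Ak Ainj; first by exists [::] => // x /Ak.
have [||m mk Am] := IH (A `&` [set x | f x < k]).
- by move=> x [].
- by move=> x y [Ax _] [Ay _]; exact: Ainj.
have [[x Ax fx]|nx] := pselect (exists2 x, A x & f x = k).
  exists (x :: m) => // y Ay; have := Ak y Ay.
  rewrite ltnS leq_eqVlt => /orP[/eqP fy|fy]; last by right; exact: Am.
  by left; apply: Ainj => //; rewrite fx fy.
exists m; first exact: leqW.
move=> y Ay; have := Ak y Ay.
rewrite ltnS leq_eqVlt => /orP[/eqP fy|fy]; last exact: Am.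
by case: nx; exists y.
Qed.

Lemma card_le_covered (A : set T) k : (A #<= `I_k)%card -> covered A k.
Proof.
move=> /pcard_leP[f]; apply: (@covered_inj f) => [x Ax|x y Ax Ay].
  exact: (@funS _ _ _ _ f x Ax).
by apply: (@inj _ _ _ f); rewrite inE.
Qed.

Lemma finite_covered (A : set T) : finite_set A -> exists k, covered A k.
Proof. by move=> /finite_set_leP[k /card_le_covered]; exists k. Qed.

Lemma covered_finite (A : set T) k : covered A k -> finite_set A.
Proof.
move=> [l _ Al]; apply: (@sub_finite_set _ _ [set` (l : seq {classic T})]).
  move=> x /Al; elim: l {Al} => //= y l IH [->|/IH]; rewrite /= inE ?eqxx //.
  by move=> ->; rewrite orbT.
exact: finite_seq.
Qed.

End Covered.

(** * Gaifman neighborhoods and isolated embeddings *)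

Section Gaifman.
Variable V : vocabulary.
Implicit Types X Y Z M N : structure V.

Definition strong_hom X Y (f : X -> Y) :=
  forall (R : V) z, interp X R z <-> interp Y R (f \o z).

Lemma edge_sym X (x y : X) : edge x y -> edge y x.
Proof. by move=> [xy [R [z [Rz xz yz]]]]; split; [exact/nesym|exists R, z]. Qed.

Definition nbhd X (A : set X) : set X :=
  A `|` [set y | exists2 x, A x & edge x y].

(** The closed [r]-neighborhood of [A] in the Gaifman graph; iterating [nbhd] makes radii add
    without any reasoning on walks. *)
Definition thicken X r (A : set X) : set X := iter r (@nbhd X) A.

Lemma thickenD X r s (A : set X) : thicken (r + s) A = thicken r (thicken s A).
Proof. exact: iterD. Qed.

Lemma thickenSr X r (A : set X) : thicken r.+1 A = thicken r (nbhd A).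
Proof. exact: iterSr. Qed.

Lemma nbhdS X (A B : set X) : A `<=` B -> nbhd A `<=` nbhd B.
Proof.
by move=> AB x [/AB|[y /AB By yx]]; [left|right; exists y].
Qed.

Lemma thickenS X r (A B : set X) : A `<=` B -> thicken r A `<=` thicken r B.
Proof. by elim: r => //= r IH AB; apply: nbhdS; exact: IH. Qed.

Lemma thicken_le X r s (A : set X) : r <= s -> thicken r A `<=` thicken s A.
Proof.
move=> /subnK <-; rewrite thickenD; elim: (s - r) => // k IH x /IH; by left.
Qed.

Lemma sub_thicken X r (A : set X) : A `<=` thicken r A.
Proof. exact: (@thicken_le _ 0). Qed.

Lemma thickenU X r (A B : set X) :
  thicken r (A `|` B) `<=` thicken r A `|` thicken r B.
Proof.
elim: r => // r IH x [/IH[]|[y /IH[] yA yx]].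
- by left; left.
- by right; left.
- by left; right; exists y.
- by right; right; exists y.
Qed.

Lemma thicken_split X r (A : set X) x :
  thicken r A x -> exists2 a, A a & thicken r [set a] x.
Proof.
elim: r x => [|r IH] x; first by exists x.
case=> [/IH[a Aa ax]|[y /IH[a Aa ay] yx]]; exists a => //; first by left.
by right; exists y.
Qed.

Lemma thicken1_sym X r (x y : X) : thicken r [set x] y -> thicken r [set y] x.
Proof.
elim: r y => [y ->//|r IH] y [/IH|[z /IH zx zy]]; first by left.
rewrite thickenSr; apply: (thickenS (A := [set z])) zx => _ ->.
by right; exists y => //; exact: edge_sym.
Qed.

Lemma thicken_closed X r (A B : set X) : A `<=` B ->
  (forall x y, B x -> edge x y -> B y) -> thicken r A `<=` B.
Proof.
move=> AB Be; elim: r => // r IH x [/IH//|[y /IH By]]; exact: Be.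
Qed.

Definition locally_bounded X D := forall x : X, covered (nbhd [set x]) D.+1.

Lemma nbhd_bigcup X (A : set X) : nbhd A `<=` \bigcup_(x in A) nbhd [set x].
Proof.
move=> x [Ax|[y Ay yx]]; first by exists x => //; left.
by exists y => //; right; exists y.
Qed.

Lemma covered_nbhd X D (A : set X) k : locally_bounded X D ->
  covered A k -> covered (nbhd A) (k * D.+1).
Proof.
move=> XD Ak; apply: covered_le (@nbhd_bigcup _ A) (leqnn _) _.
by apply: covered_bigcup => // x _; exact: XD.
Qed.

Lemma covered_thicken X D r (A : set X) k : locally_bounded X D ->
  covered A k -> covered (thicken r A) (k * D.+1 ^ r).
Proof.
move=> XD Ak; elim: r => [|r IH]; first by rewrite expn0 muln1.
by rewrite expnSr mulnA; exact: covered_nbhd.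
Qed.

Lemma covered1 (T : Type) (x : T) : covered [set x] 1.
Proof. by exists [:: x] => // _ ->; left. Qed.

Lemma degree_locally_bounded X D : degree_bounded_by X D -> locally_bounded X D.
Proof.
move=> XD x; rewrite -add1n; apply: coveredU; first exact: covered1.
apply: covered_le (leqnn _) (card_le_covered (XD x)) => y [_ -> //].
Qed.

Lemma edge_of_interp X (R : V) (z : 'I_(arity R) -> X) i j :
  interp X R z -> z i = z j \/ edge (z i) (z j).
Proof.
move=> Rz; have [->|zij] := pselect (z i = z j); [by left|right].
by split=> //; exists R, z; split=> //; [exists i|exists j].
Qed.

Lemma nbhd_interp X (A : set X) (R : V) (z : 'I_(arity R) -> X) i j :
  interp X R z -> A (z i) -> nbhd A (z j).
Proof.
move=> /(edge_of_interp i j)[->|e] Az; [by left|by right; exists (z i)].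
Qed.

(** The last clause makes the image a union of Gaifman components, so no true tuple of [M] meets
    both the image and its complement. *)
Definition isolated_embedding Y M (f : Y -> M) :=
  [/\ injective f, strong_hom f & forall y x, edge (f y) x -> exists y', f y' = x].

Lemma strong_hom_comp X Y Z (f : X -> Y) (g : Y -> Z) :
  strong_hom f -> strong_hom g -> strong_hom (g \o f).
Proof. by move=> fP gP R z; rewrite fP gP. Qed.

Lemma strong_hom_edge X Y (f : X -> Y) x y :
  injective f -> strong_hom f -> edge x y -> edge (f x) (f y).
Proof.
move=> fI fP [xy [R [z [Rz [i zx] [j zy]]]]]; split; first by move/fI.
exists R, (f \o z); split; first exact/fP.
- by exists i; rewrite /= zx.
- by exists j; rewrite /= zy.
Qed.

Lemma isolated_interp Y M (f : Y -> M) (R : V) z i y :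
  isolated_embedding f -> interp M R z -> z i = f y ->
  exists2 w : 'I_(arity R) -> Y, z = f \o w & interp Y R w.
Proof.
move=> [fI fP fE] Rz zi.
have /choice[w zw] : forall j, exists y', z j = f y'.
  move=> j; case: (edge_of_interp i j Rz) => [<-|]; first by exists y.
  by rewrite zi => /fE[y' <-]; exists y'.
have {}zw : z = f \o w by apply/funext.
by exists w => //; apply/fP; rewrite -zw.
Qed.

(** An induced embedding alone may fail to reflect edges, since the witnessing tuple can use points
    outside the image; isolation forces the whole tuple inside. *)
Lemma isolated_edge Y M (f : Y -> M) x y :
  isolated_embedding f -> edge (f x) (f y) -> edge x y.
Proof.
move=> fP [fxy [R [z [Rz [i zi] [j zj]]]]]; split.
  by move=> xy; apply: fxy; rewrite xy.
have [w zw Rw] := isolated_interp fP Rz zi; have [fI _ _] := fP.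
exists R, w; split=> //; first by exists i; apply: fI; rewrite -zi zw.
by exists j; apply: fI; rewrite -zj zw.
Qed.

Lemma isolated_embedding_comp X Y Z (f : X -> Y) (g : Y -> Z) :
  isolated_embedding f -> isolated_embedding g -> isolated_embedding (g \o f).
Proof.
move=> [fI fP fE] gP'; have [gI gP gE] := gP'; split; first exact: inj_comp.
  exact: strong_hom_comp.
move=> x z /= fgz; have [y yz] := gE _ _ fgz; rewrite -yz in fgz *.
by have [x' <-] := fE x y (isolated_edge gP' fgz); exists x'.
Qed.

Lemma isomorphic_sym X Y : isomorphic X Y -> isomorphic Y X.
Proof.
move=> [f [g fK gK] fP]; exists g; first by exists f.
by move=> R z; rewrite fP; have -> : f \o (g \o z) = z by apply/funext => k /=.
Qed.

Lemma isomorphic_isolated X Y :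
  isomorphic X Y -> exists f : X -> Y, isolated_embedding f.
Proof.
move=> [f [g fK gK] fP]; exists f; split=> //; first exact: can_inj fK.
by move=> y x _; exists (g x).
Qed.

Lemma embedding_isomorphic X Y (f : X -> Y) (A : set Y) :
  injective f -> strong_hom f -> range f = A -> isomorphic X (substructure A).
Proof.
move=> fI fP <-.
pose g (x : X) : substructure (range f) :=
  exist _ (f x) (mem_set (ex_intro2 _ _ x I erefl)).
have gI : injective g by move=> x y /(congr1 val) /fI.
exists g; last by move=> R z; rewrite fP.
have /choice[h hK] : forall y, exists x, g x = y.
  move=> [y yP]; have [x _ xy] := set_mem yP; exists x.
  exact: val_inj.
by exists h => // x; apply: gI; rewrite hK.
Qed.

Lemma strong_hom_val X (A : set X) : strong_hom (val : substructure A -> X).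
Proof. by []. Qed.

End Gaifman.
(** * The Ehrenfeucht-Fraisse game *)

Section BackAndForth.
Variable V : vocabulary.
Implicit Types X Y Z M N : structure V.

(** A relation instead of a partial function, so that exchanging the two structures only swaps
    arguments; the first clause makes it single-valued both ways. *)
Definition partial_iso M N (p : M -> N -> Prop) :=
  (forall x y x' y', p x y -> p x' y' -> (x = x' <-> y = y')) /\
  (forall (R : V) z w, (forall k : 'I_(arity R), p (z k) (w k)) ->
     (interp M R z <-> interp N R w)).

Lemma partial_iso_flip M N (p : M -> N -> Prop) :
  partial_iso p -> partial_iso (fun y x => p x y).
Proof.
move=> [pf pR]; split; first by move=> x y x' y' pxy pxy'; rewrite (pf y x y' x').
by move=> R z w pzw; rewrite (pR R w z).
Qed.

(** Edges are transported one at a time: the tuple behind an edge leaving [thicken r A] lies in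
    [thicken r.+1 A], hence wholly in the domain of [p], and its image is again a true tuple. *)
Lemma partial_iso_thicken M N (p : M -> N -> Prop) r A B :
  partial_iso p -> (forall x y, A x -> p x y -> B y) ->
  thicken r A `<=` [set x | exists y, p x y] ->
  forall x y, thicken r A x -> p x y -> thicken r B y.
Proof.
move=> [pf pR] AB; elim: r => // r IH Ap x y rx pxy.
have {}IH := IH (subset_trans (@thicken_le _ _ r r.+1 A (leqnSn r)) Ap).
case: rx => [rx|[x0 rx0 [xx0 [R [z [Rz [i zi] [j zj]]]]]]].
  by left; exact: IH pxy.
have /choice[w zw] : forall k, exists y, p (z k) y.
  by move=> k; apply: Ap; apply: (nbhd_interp (i := i) k Rz); rewrite zi.
have wj : w j = y by apply/(pf (z j) (w j) x y (zw j) pxy).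
rewrite -wj; apply: (nbhd_interp (R := R) (z := w) (i := i)).
  by apply/(pR R z w).
by apply: IH rx0 _; rewrite -zi.
Qed.

(** The invariant of the game, with [r] the radius still kept matched around the chosen points; [p]
    may relate more than these neighborhoods, which lets [r] shrink. *)
Definition back_and_forth M N r (p : M -> N -> Prop) n
    (v : 'I_n -> M) (w : 'I_n -> N) :=
  [/\ partial_iso p, forall i, p (v i) (w i),
      thicken r (range v) `<=` [set x | exists y, p x y] &
      thicken r (range w) `<=` [set y | exists x, p x y]].

Lemma back_and_forth_flip M N r (p : M -> N -> Prop) n v w :
  @back_and_forth M N r p n v w -> back_and_forth r (fun y x => p x y) w v.
Proof. by move=> [ip vw vp wp]; split=> //; exact: partial_iso_flip. Qed.

Lemma back_and_forth_le M N r s (p : M -> N -> Prop) n v w : s <= r ->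
  @back_and_forth M N r p n v w -> back_and_forth s p v w.
Proof.
move=> sr [ip vw vp wp]; split=> // x xs; [apply: vp|apply: wp];
  exact: thicken_le xs.
Qed.

Lemma range_extend (T : Type) n (x : T) (v : 'I_n -> T) :
  range (extend x v) = range v `|` [set x].
Proof.
apply/seteqP; split=> [_ [i _ <-]|y [[i _ <-]|->]].
- by rewrite /extend; case: unliftP => [j _|_]; [left; exists j|right].
- by exists (lift ord0 i) => //; rewrite /extend liftK.
- by exists ord0 => //; rewrite /extend unlift_none.
Qed.

Lemma extendP (T U : Type) (P : T -> U -> Prop) n (x : T) (y : U) v w :
  (forall i : 'I_n, P (v i) (w i)) -> P x y ->
  forall i, P (extend x v i) (extend y w i).
Proof. by move=> vw xy i; rewrite /extend; case: unliftP => [j _|_] /=. Qed.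

Variable C : structure V -> Prop.

Definition rich K M := forall Y, C Y -> covered [set: Y] K ->
  forall F : set M, covered F K ->
  exists2 f : Y -> M, isolated_embedding f & forall y, ~ F (f y).

(** [M] itself need not belong to [C]: the disjoint union of all members may be infinite, while its
    balls are members. *)
Definition locally_in D M :=
  locally_bounded M D /\ forall r x, C (substructure (thicken r [set x] : set M)).

Lemma rich_le J K M : J <= K -> rich K M -> rich J M.
Proof.
move=> JK MK Y CY YJ F FJ.
by apply: MK CY _ _ _; [exact: covered_le YJ|exact: covered_le FJ].
Qed.

(* A new point [x] at distance at most [2 r + 1] from the old ones is answered
   by [p] itself. Otherwise the [r]-neighborhood of [x] is not adjacent to those
   of the old points, and it is copied to some union of components of [N]
   that misses the [r]-neighborhoods of the old answers. *)
Lemma forth M N D r n (p : M -> N -> Prop) (v : 'I_n -> M) (w : 'I_n -> N) x :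
  locally_in D M -> locally_in D N -> rich (n.+1 * D.+1 ^ r) N ->
  back_and_forth (r + (r + r.+1)) p v w ->
  exists (y : N) (q : M -> N -> Prop),
    back_and_forth r q (extend x v) (extend y w).
Proof.
move=> [MD MC] [ND NC] Nrich pvw; have [ip vw vp wp] := pvw.
have vwp a b : range v a -> p a b -> range w b.
  move=> [i _ <-] pb; have [pf _] := ip.
  by exists i => //; apply/(pf (v i) (w i) (v i) b (vw i) pb).
have wvp b a : range w b -> p a b -> range v a.
  move=> [i _ <-] pa; have [pf _] := ip.
  by exists i => //; apply/(pf (v i) (w i) a (w i) (vw i) pa).
(* The radius [3 r + 1] is used here: the [r]-ball of a point at distance at most [2 r + 1] still
   lies in the domain of [p]. *)
have [xv|xv] := pselect (thicken (r + r.+1) (range v) x).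
  have sub_p : thicken (r + r.+1) (range v) `<=` [set a | exists b, p a b].
    by move=> a ar; apply: vp; exact: thicken_le (leq_addl _ _) _ ar.
  have [y pxy] : exists y, p x y by exact: sub_p.
  have yw : thicken (r + r.+1) (range w) y.
    exact: partial_iso_thicken ip vwp sub_p x y xv pxy.
  exists y, p; split=> //; first exact: extendP.
  - rewrite range_extend => a ra; apply: vp; rewrite thickenD.
    apply: thickenS ra => b [|->] //; exact: sub_thicken.
  - rewrite range_extend => a ra; apply: wp; rewrite thickenD.
    apply: thickenS ra => b [|->] //; exact: sub_thicken.
pose Y := substructure (thicken r [set x]).
have D0 : 0 < D.+1 ^ r by rewrite expn_gt0.
(* The bound [n.+1 * D.+1 ^ r] covers both the [r]-ball of [x], with at most [D.+1 ^ r] points, and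
   the [r]-neighborhood of the [n] old answers. *)
have YK : covered [set: Y] (n.+1 * D.+1 ^ r).
  have : covered (thicken r [set x]) (n.+1 * D.+1 ^ r).
    apply: covered_le (covered_thicken r MD (covered1 x)) => //.
    by rewrite leq_mul2r orbC.
  move=> /(@covered_preimage _ Y val _ _ val_inj); apply: covered_le => //.
  by move=> y _; exact: set_mem (valP y).
have FK : covered (thicken r (range w)) (n.+1 * D.+1 ^ r).
  have wn : covered (range w) n.
    apply: covered_image; exists (enum 'I_n); first by rewrite size_enum_ord.
    move=> i _; have : i \in enum 'I_n by rewrite mem_enum.
    by elim: (enum _) => //= j l IH; rewrite inE => /orP[/eqP ->|/IH]; [left|right].
  apply: covered_le (covered_thicken r ND wn) => //.
  by rewrite leq_mul2r leqnSn orbT.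
have [g gI gw] := Nrich Y (MC r x) YK _ FK.
have [ginj gP gE] := gI.
pose x0 : Y := exist _ x (mem_set (sub_thicken r (erefl : [set x] x))).
(* [p] is cut down to the [r]-neighborhood of the old points, since elsewhere it could clash with
   [g]. *)
pose q a b := (p a b /\ thicken r (range v) a) \/
  exists u : Y, a = val u /\ b = g u.
have sub_rr : r <= r + (r + r.+1) by exact: leq_addr.
have vpr : thicken r (range v) `<=` [set a | exists b, p a b].
  by move=> a ar; apply: vp; exact: thicken_le sub_rr _ ar.
have wpr : thicken r (range w) `<=` [set b | exists a, p a b].
  by move=> a ar; apply: wp; exact: thicken_le sub_rr _ ar.
have pr a b : p a b -> thicken r (range v) a -> thicken r (range w) b.
  by move=> pab ar; exact: partial_iso_thicken ip vwp vpr a b ar pab.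
have pr' a b : p a b -> thicken r (range w) b -> thicken r (range v) a.
  move=> pab br.
  exact: partial_iso_thicken (partial_iso_flip ip) wvp wpr b a br pab.
have far a (u : Y) : thicken r (range v) a -> ~ nbhd [set a] (val u).
  move=> ar au; apply: xv; rewrite thickenD.
  have := thicken1_sym (set_mem (valP u)); apply: thickenS => _ ->.
  by apply: nbhdS au => _ ->.
have far' b (u : Y) : thicken r (range w) b -> ~ nbhd [set b] (g u).
  move=> br [bu|[_ -> /edge_sym/gE[u' bu]]].
    by apply: (gw u); rewrite bu.
  by apply: (gw u'); rewrite bu.
have farI a (u : Y) : thicken r (range v) a -> a <> val u.
  by move=> /far au aE; apply: (au u); left.
have farI' b (u : Y) : thicken r (range w) b -> b <> g u.
  by move=> /far' bu bE; apply: (bu u); left.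
exists (g x0), q; split.
- split.
    move=> a b a' b' [[pab ar]|[u [-> ->]]] [[pab' ar']|[u' [-> ->]]].
    + by have [pf _] := ip; exact: pf.
    + split=> [/farI//|/farI'[]]; exact: pr ar.
    + split=> [/esym/farI//|/esym/farI'[]]; exact: pr ar'.
    + by split=> [/val_inj ->|/ginj ->].
  move=> R z t zt; have k0 : 'I_(arity R) := Ordinal (arity_gt0 R).
  have [zl|nzl] := pselect (forall k, p (z k) (t k)); first by have [_] := ip; exact.
  have [zr|nzr] := pselect (forall k, exists u : Y, z k = val u /\ t k = g u).
    have /choice[u uP] := zr.
    have -> : t = g \o u by apply/funext => k; case: (uP k).
    rewrite -gP; have -> : z = (fun k => val (u k)) by apply/funext => k; case: (uP k).
    by [].
  (* A tuple mixing the old part and the copy is true in neither structure: its entries would be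
     equal or adjacent across the gap. *)
  have [i ni] : exists k, ~ p (z k) (t k) by exact/existsNP.
  have [j nj] : exists k, ~ exists u : Y, z k = val u /\ t k = g u by exact/existsNP.
  have [[]//|[u [zi ti]]] := zt i.
  have [[pj rj]|//] := zt j.
  split=> Ri; exfalso.
  + by apply: (far _ u rj); rewrite -zi; exact: (nbhd_interp i Ri).
  + by apply: (far' _ u (pr _ _ pj rj)); rewrite -ti; exact: (nbhd_interp i Ri).
- apply: extendP => [i|]; last by right; exists x0.
  by left; split=> //; apply: sub_thicken; exists i.
- rewrite range_extend => a /thickenU[ar|ax].
    by have [b pab] := vpr _ ar; exists b; left.
  by exists (g (exist _ a (mem_set ax))); right; exists (exist _ a (mem_set ax)).
- rewrite range_extend => b /thickenU[br|].
    by have [a pab] := wpr _ br; exists a; left; split=> //; exact: pr' br.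
  (* The image of [g] is closed under edges, so it contains the whole [r]-ball of the answer. *)
  have: [set g x0] `<=` range g by move=> _ ->; exists x0.
  move=> /(@thicken_closed _ _ r) H /H[].
    by move=> _ c [u _ <-] /gE[u' <-]; exists u'.
  by move=> u _ <-; exists (val u); right; exists u.
Qed.

Lemma satisfies_extend_iff T U n (v : 'I_n -> T) (w : 'I_n -> U)
    (P : ('I_n.+1 -> T) -> Prop) (Q : ('I_n.+1 -> U) -> Prop) :
  (forall x, exists y, P (extend x v) <-> Q (extend y w)) ->
  (forall y, exists x, P (extend x v) <-> Q (extend y w)) ->
  ((forall x, P (extend x v)) <-> (forall y, Q (extend y w))) /\
  ((exists x, P (extend x v)) <-> (exists y, Q (extend y w))).
Proof.
move=> f b; split; split.
- by move=> H y; have [x <-] := b y.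
- by move=> H x; have [y ->] := f x.
- by move=> [x]; have [y ->] := f x; exists y.
- by move=> [y]; have [x <-] := b y; exists x.
Qed.

(** Induction on the formula. [r] and [K] are chosen before the structures; each quantifier replaces
    [r] by [3 r + 1] and raises [K] to the size that answering one more move requires. *)
Lemma back_and_forth_satisfies D n (phi : formula V n) :
  exists r K, forall M N (p : M -> N -> Prop) v w,
    locally_in D M -> locally_in D N -> rich K M -> rich K N ->
    back_and_forth r p v w -> satisfies phi v <-> satisfies phi w.
Proof.
have quantifier m (f : formula V m.+1) :
    (exists r K, forall M N (p : M -> N -> Prop) v w,
      locally_in D M -> locally_in D N -> rich K M -> rich K N ->
      back_and_forth r p v w -> satisfies f v <-> satisfies f w) ->
    exists r K, forall M N (p : M -> N -> Prop) (v : 'I_m -> M) (w : 'I_m -> N),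
      locally_in D M -> locally_in D N -> rich K M -> rich K N ->
      back_and_forth r p v w ->
      ((forall x, satisfies f (extend x v)) <->
       (forall y, satisfies f (extend y w))) /\
      ((exists x, satisfies f (extend x v)) <->
       (exists y, satisfies f (extend y w))).
  move=> [r [K IH]]; exists (r + (r + r.+1)), (maxn K (m.+1 * D.+1 ^ r)).
  move=> M N p v w MC NC MK NK pvw.
  have MKl := rich_le (leq_maxl _ _) MK; have MKr := rich_le (leq_maxr _ _) MK.
  have NKl := rich_le (leq_maxl _ _) NK; have NKr := rich_le (leq_maxr _ _) NK.
  apply: satisfies_extend_iff => [x|y].
    have [y [q qP]] := forth x MC NC NKr pvw.
    by exists y; exact: IH qP.
  have pvw' := back_and_forth_flip pvw.
  have [x [q qP]] := forth y NC MC MKr pvw'.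
  exists x; apply: IH (back_and_forth_flip qP) => //.
have binary m (f g : formula V m) :
    (exists r K, forall M N (p : M -> N -> Prop) v w,
      locally_in D M -> locally_in D N -> rich K M -> rich K N ->
      back_and_forth r p v w -> satisfies f v <-> satisfies f w) ->
    (exists r K, forall M N (p : M -> N -> Prop) v w,
      locally_in D M -> locally_in D N -> rich K M -> rich K N ->
      back_and_forth r p v w -> satisfies g v <-> satisfies g w) ->
    exists r K, forall M N (p : M -> N -> Prop) v w,
      locally_in D M -> locally_in D N -> rich K M -> rich K N ->
      back_and_forth r p v w -> (satisfies f v <-> satisfies f w) /\
                                (satisfies g v <-> satisfies g w).
  move=> [r [K IHf]] [s [L IHg]]; exists (maxn r s), (maxn K L).
  move=> M N p v w MC NC MK NK pvw.
  have MKl := rich_le (leq_maxl _ _) MK; have MKr := rich_le (leq_maxr _ _) MK.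
  have NKl := rich_le (leq_maxl _ _) NK; have NKr := rich_le (leq_maxr _ _) NK.
  split; [apply: IHf|apply: IHg] => //.
    exact: back_and_forth_le (leq_maxl _ _) pvw.
  exact: back_and_forth_le (leq_maxr _ _) pvw.
elim: phi => {n}.
- by move=> n; exists 0, 0.
- move=> n i j; exists 0, 0 => M N p v w _ _ _ _ [[pf _] vw _ _] /=.
  exact: pf.
- move=> n R a; exists 0, 0 => M N p v w _ _ _ _ [[_ pR] vw _ _] /=.
  by apply: pR => k; exact: vw.
- move=> n f [r [K IH]]; exists r, K => M N p v w MC NC MK NK pvw /=.
  by rewrite (IH M N p v w).
- move=> n f IHf g IHg; have [r [K IH]] := binary _ f g IHf IHg.
  exists r, K => M N p v w MC NC MK NK /(IH M N p v w MC NC MK NK)[/= fE gE].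
  by rewrite fE gE.
- move=> n f IHf g IHg; have [r [K IH]] := binary _ f g IHf IHg.
  exists r, K => M N p v w MC NC MK NK /(IH M N p v w MC NC MK NK)[/= fE gE].
  by rewrite fE gE.
- move=> n f IHf g IHg; have [r [K IH]] := binary _ f g IHf IHg.
  exists r, K => M N p v w MC NC MK NK /(IH M N p v w MC NC MK NK)[/= fE gE].
  by rewrite fE gE.
- move=> n f /quantifier[r [K IH]]; exists r, K => M N p v w MC NC MK NK pvw /=.
  by have [] := IH M N p v w MC NC MK NK pvw.
- move=> n f /quantifier[r [K IH]]; exists r, K => M N p v w MC NC MK NK pvw /=.
  by have [] := IH M N p v w MC NC MK NK pvw.
Qed.

Lemma rich_models D (phi : sentence V) : exists K, forall M N,
  locally_in D M -> locally_in D N -> rich K M -> rich K N ->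
  models M phi <-> models N phi.
Proof.
have [r [K phiP]] := back_and_forth_satisfies D phi.
exists K => M N MC NC MK NK.
apply: (phiP M N (fun _ _ => False)) => //; split.
(* Positive arity matters: only a tuple without entries could be related by the empty relation. *)
- by split=> // R z w /(_ (Ordinal (arity_gt0 R))).
- by move=> i; have := ltn_ord i.
- by move=> x /thicken_split[a [i]]; have := ltn_ord i.
- by move=> x /thicken_split[a [i]]; have := ltn_ord i.
Qed.

End BackAndForth.
(** * Disjoint unions and richness *)

Section DisjointUnions.
Variable V : vocabulary.
Implicit Types W X Y Z M N : structure V.

Lemma isolated_union_inj (I : Type) (F : I -> structure V) i :
  @isolated_embedding V (F i) (disjoint_union F) (existT F i).
Proof.
have tagI j (x y : F j) : existT F j x = existT F j y -> x = y.
  by move=> e; have := projT2_eq e; rewrite (Prop_irrelevance (projT1_eq e) erefl).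
split; first exact: tagI.
  move=> R z; split=> [Rz|[j [w [Rw zw]]]]; first by exists i, z.
  (* As arities are positive, the first entry determines the summand. *)
  have := congr1 (fun t => projT1 (t (Ordinal (arity_gt0 R)))) zw.
  move=> /= ij; subst j.
  have -> // : z = w.
  by apply/funext => k; apply: tagI; exact: (congr1 (@^~ k) zw).
move=> y x [_ [R [_ [[j [w [Rw ->]]] [a ya] [b <-]]]]].
have := congr1 (@projT1 _ _) ya => /= ij; subst j.
by exists (w b).
Qed.

Lemma preimage_substructure Y M (f : Y -> M) (A : set M) :
  injective f -> strong_hom f -> A `<=` range f ->
  isomorphic (substructure (f @^-1` A)) (substructure A).
Proof.
move=> fI fP Af.
apply: (@embedding_isomorphic _ _ _ (fun u : substructure (f @^-1` A) => f (val u))).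
- by move=> u u' /fI/val_inj.
- by move=> R z; rewrite /= fP.
- apply/seteqP; split=> [_ [u _ <-]|x Ax]; first exact: set_mem (valP u).
  have [y _ yx] := Af x Ax.
  have Ay : y \in f @^-1` A by rewrite inE /= yx.
  by exists (exist _ y Ay).
Qed.

(** Relations on ['I_n] as boolean tables: the codes of one size form a finite type, and all codes
    together a countable one. *)
Definition fin_code n := {ffun {R : V & {ffun 'I_(arity R) -> 'I_n}} -> bool}.

Definition fin_decode (c : {n : nat & fin_code n}) : structure V :=
  Structure (carrier := 'I_(tag c))
    (fun R z => tagged c (Tagged (fun R : V => _) [ffun k => z k])).

Lemma In_mem (T : eqType) (x : T) (s : seq T) : List.In x s -> x \in s.
Proof.
by elim: s => //= y s IH [->|/IH xs]; rewrite inE ?eqxx // xs orbT.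
Qed.

Lemma fin_decode_surj Y K : covered [set: Y] K ->
  exists2 c, tag c <= K & isomorphic Y (fin_decode c).
Proof.
move=> YK; have /finite_setP[n YI] := covered_finite YK.
have /card_bijP[f [g fK gK]] : ([set: Y] #= [set: 'I_n])%card.
  exact: card_eq_trans YI card_II.
pose f' (y : Y) : 'I_n := val (f (exist _ y (@mem_set _ setT y I))).
pose g' (i : 'I_n) : Y := val (g (exist _ i (@mem_set _ setT i I))).
have f'K : cancel f' g'.
  move=> y; rewrite /f' /g'; set u := exist _ (val _) _.
  have -> : u = f (exist _ y (@mem_set _ setT y I)) by exact: val_inj.
  by rewrite fK.
have g'K : cancel g' f'.
  move=> i; rewrite /f' /g'; set u := exist _ (val _) _.
  have -> : u = g (exist _ i (@mem_set _ setT i I)) by exact: val_inj.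
  by rewrite gK.
pose c : fin_code n := [ffun t : {R : V & {ffun 'I_(arity R) -> 'I_n}} =>
  `[< interp Y (tag t) (fun k => g' (tagged t k)) >]].
exists (Tagged fin_code c).
  have [l lK Yl] := covered_image f' YK; apply: leq_trans lK.
  rewrite -[X in X <= _]size_enum_ord; apply: uniq_leq_size (enum_uniq _) _.
  by move=> i _; apply: In_mem; apply: Yl; exists (g' i).
exists f'; first by exists g'.
move=> R z /=; rewrite ffunE /= asboolE.
suff -> : (fun k => g' ([ffun k => f' (z k)] k)) = z by [].
by apply/funext => k /=; rewrite ffunE f'K.
Qed.

Variable C : structure V -> Prop.
Hypotheses (C_nonempty : exists Y, C Y) (C_iso : iso_closed C)
  (C_union : disjoint_union_closed C).

(** [U] consists of [k + 1] disjoint copies of [W], and [k] points cannot meet them all. *)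
Lemma disjoint_copies W k : C W -> exists2 U, C U &
  forall F : set U, covered F k ->
    exists2 f : W -> U, isolated_embedding f & forall w, ~ F (f w).
Proof.
move=> CW; elim: k => [|k [U CU Uk]].
  exists W => // F [[|//] _ F0]; exists id => [|w /F0//].
  by split=> // y x _; exists x.
exists (disjoint_union (fun b : bool => if b then U else W)).
  exact: C_union.
set D := disjoint_union _ => F [l lk Fl].
have Ui : @isolated_embedding V U D (fun u => existT _ true u).
  exact: (isolated_union_inj (fun b : bool => if b then U else W) true).
have Wi : @isolated_embedding V W D (fun w => existT _ false w).
  exact: (isolated_union_inj (fun b : bool => if b then U else W) false).
have [[w Fw]|nF] := pselect (exists w : W, F (existT _ false w)); last first.
  by exists (fun w => existT _ false w) => // w Fw; apply: nF; exists w.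
(* The last copy meets [F], so one listed point lies there and at most [k] remain for the copies in
   [U]. *)
have [l1 [l2 lE]] := List.in_split _ _ (Fl _ Fw).
pose inU (u : U) : D := existT _ true u.
have Fk : covered (F `&` range inU) k.
  exists (l1 ++ l2); last first.
    move=> x [Fx [u _ ux]]; have := Fl _ Fx; rewrite lE => xl.
    apply: List.in_or_app.
    case: (List.in_app_or _ _ _ xl) => [|[xw|]]; [by left| |by right].
    by move: ux; rewrite -xw => /(congr1 (@projT1 _ _)).
  by move: lk; rewrite lE !size_cat /= addnS.
have inUI : injective inU by case: Ui.
have [f fi fF] := Uk _ (covered_preimage inUI Fk).
exists (inU \o f); first exact: isolated_embedding_comp.
by move=> x Fx; apply: (fF x); split=> //; exists (f x).
Qed.

Lemma isolated_code_union (s : seq {n : nat & fin_code n}) : exists2 W, C W &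
  forall c, c \in s -> C (fin_decode c) ->
    exists f : fin_decode c -> W, isolated_embedding f.
Proof.
elim: s => [|c s [W CW Ws]]; first by have [Y CY] := C_nonempty; exists Y.
have [Cc|nCc] := pselect (C (fin_decode c)); last first.
  by exists W => // d; rewrite inE => /orP[/eqP ->//|]; exact: Ws.
pose F b := if b then fin_decode c else W.
exists (disjoint_union F); first exact: C_union.
move=> d; rewrite inE => /orP[/eqP -> _|ds Cd].
  by exists (existT F true); exact: (isolated_union_inj F true).
have [f fi] := Ws d ds Cd.
exists (existT F false \o f).
exact: isolated_embedding_comp (isolated_union_inj F false).
Qed.

(** [W] is made of [K + 1] copies of a union [W1] in which each member of size at most [K] is
    isolated. A set of [K] points misses one of these copies of [W1]. *)
Lemma rich_witness K : exists2 W, C W &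
  forall M (h : W -> M), isolated_embedding h -> rich C K M.
Proof.
pose s := [seq (existT fin_code n c) | n <- iota 0 K.+1, c <- enum {: fin_code n}].
have [W1 CW1 W1s] := isolated_code_union s.
have [W CW WK] := disjoint_copies K CW1.
exists W => // M h hi Y CY YK F FK.
have [c cK Yc] := fin_decode_surj YK.
have [|f fi] := W1s c _ (C_iso Yc CY).
  apply/allpairsPdep; exists (tag c), (tagged c); split.
  - by rewrite mem_iota.
  - by rewrite mem_enum.
  - by case: c {cK Yc}.
have [hI _ _] := hi; have [e ei eF] := WK _ (covered_preimage hI FK).
have [g gi] := isomorphic_isolated Yc.
exists (h \o (e \o (f \o g))) => [|y]; last exact: (eF (f (g y))).
by do 3 apply: isolated_embedding_comp => //.
Qed.

Variables (D : nat) (I : Type) (rep : I -> structure V).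
Hypotheses (C_degree : forall Y, C Y -> degree_bounded_by Y D)
  (C_sub : substructure_closed C) (C_rep : representatives C rep).

Lemma locally_in_member Y : C Y -> locally_in C D Y.
Proof.
move=> CY; split=> [|r x]; last exact: C_sub.
by apply: degree_locally_bounded; exact: C_degree.
Qed.

(** A ball of the disjoint union stays inside one summand, so it is isomorphic to a substructure of
    a member. *)
Lemma union_locally_in : locally_in C D (disjoint_union rep).
Proof.
have [Crep _] := C_rep; split=> [[i y]|r [i y]].
  have inj := isolated_union_inj rep i.
  have [Dy _] := locally_in_member (Crep i).
  apply: covered_le (leqnn _) (covered_image (existT rep i) (Dy y)).
  move=> x [->|[_ -> yx]]; first by exists y => //; left.
  have [_ _ injE] := inj; have [y' yx'] := injE _ _ yx.
  rewrite -yx' in yx *; exists y' => //; right; exists y => //.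
  exact: isolated_edge inj yx.
have [injI injP injE] := isolated_union_inj rep i.
apply: C_iso (preimage_substructure injI injP _) (C_sub _ (Crep i)).
apply: thicken_closed => [_ ->|_ x [u _ <-]]; first by exists y.
by move=> /injE[y' <-]; exists y'.
Qed.

Lemma union_rich K : rich C K (disjoint_union rep).
Proof.
have [W CW WK] := rich_witness K; have [_ repC] := C_rep.
have [i [Wi _]] := repC W CW; have [f fi] := isomorphic_isolated Wi.
exact: (WK (disjoint_union rep) _ (isolated_embedding_comp fi (isolated_union_inj rep i))).
Qed.

End DisjointUnions.
(** * Random subsets *)

Section FiniteAvoidance.
Local Open Scope set_scope.

(** For a uniformly random [A] satisfying [P], the trace on [N] is uniform since [P] ignores it, so
    it equals [W] with probability at least [2 ^ - c]. The inequality is cleared of denominators. *)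
Lemma card_avoid (T : finType) (N W : {set T}) (P : pred {set T}) c :
  W \subset N -> #|N| <= c -> (forall A, P A = P (A :\: N)) ->
  #|[set A | P A && (A :&: N != W)]| * 2 ^ c <=
  #|[set A | P A]| * (2 ^ c).-1.
Proof.
move=> WN Nc PN.
have WN0 : W :\: N = finset.set0 by apply/eqP; rewrite finset.setD_eq0.
pose E := [set A | P A & A :&: N == W].
have PE : #|[set A | P A]| = #|E| + #|[set A | P A && (A :&: N != W)]|.
  rewrite -(cardsID [set A : {set T} | A :&: N == W] [set A | P A]).
  by congr (_ + _); apply: eq_card => A; rewrite !inE // andbC.
have leE : #|[set A | P A]| <= #|E| * 2 ^ c.
  apply: (@leq_trans (#|E| * 2 ^ #|N|)); last first.
    by rewrite leq_mul2l leq_exp2l // Nc orbT.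
  rewrite -card_powerset -cardsX.
  (* Replacing the trace of [A] on [N] by [W] and recording the old trace loses no information. *)
  pose f (A : {set T}) := ((A :\: N) :|: W, A :&: N).
  have fI : injective f.
    move=> A B [AB1 AB2].
    rewrite -(finset.setID A N) -(finset.setID B N) AB2; congr (_ :|: _).
    have DW (A' : {set T}) : A' :\: N = ((A' :\: N) :|: W) :\: N.
      by rewrite finset.setDUl finset.setDDl finset.setUid WN0 finset.setU0.
    by rewrite DW AB1 -DW.
  rewrite -(card_imset _ fI); apply/subset_leq_card/fintype.subsetP => _ /imsetP[A PA ->].
  rewrite !inE in PA *; rewrite finset.subsetIr andbT.
  have -> : P (A :\: N :|: W).
    rewrite PN finset.setDUl WN0.
    by rewrite finset.setU0 -PN -PN.
  rewrite finset.setIUl finset.setIDAC -finset.setIDA finset.setDv finset.setI0 finset.set0U.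
  exact/eqP/finset.setIidPl.
rewrite -subn1 mulnBr muln1 leq_subRL; first by rewrite {2}PE mulnDl leq_add2r.
by rewrite -[X in X <= _]muln1 leq_mul // expn_gt0.
Qed.

End FiniteAvoidance.

Section Counting.
Variable X : Type.
Implicit Types (A B G : set X) (P Q : set (set X)).

Definition count_subsets B P := #|` fset_set [set A | A `<=` B /\ P A]|.

Lemma set_of_finset (T : finType) (h : T -> X) P :
  [set A | A `<=` range h /\ P A] =
  (fun S : {set T} => h @` [set` S]) @`
    [set` [set S : {set T} | `[< P (h @` [set` S]) >]]%SET].
Proof.
apply/seteqP; split=> [A [Ah PA]|A [S /=]]; last first.
  rewrite inE => /asboolP PS <-; split=> // x [t _ tx]; by exists t.
pose S := [set t : T | `[< A (h t) >]]%SET.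
have hS : h @` [set` S] = A.
  apply/seteqP; split=> [x [t /= tS <-]|x Ax].
    by move: tS; rewrite inE => /asboolP.
  have [t _ tx] := Ah x Ax; exists t => //=.
  by rewrite inE; apply/asboolP; rewrite tx.
by exists S => //=; rewrite inE hS; apply/asboolP.
Qed.

Lemma finite_range B : finite_set B ->
  exists (T : finType) (h : T -> X), injective h /\ range h = B.
Proof.
move=> Bfin; pose F : {fset {classic X}} := fset_set (B : set {classic X}).
exists F, val; split; first exact: val_inj.
apply/seteqP; split=> [_ [u _ <-]|x Bx].
  by have := valP u; rewrite in_fset_set // inE.
have xF : (x : {classic X}) \in F by rewrite in_fset_set // inE.
by exists [` xF]%fset.
Qed.

Lemma finite_subsets B P : finite_set B -> finite_set [set A | A `<=` B /\ P A].
Proof.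
move=> /finite_range[T [h [_ <-]]]; rewrite set_of_finset.
by apply: finite_image; exact: finite_finset.
Qed.

Lemma count_subsets_card (T : finType) (h : T -> X) P : injective h ->
  count_subsets (range h) P = #|[set S : {set T} | `[< P (h @` [set` S]) >]]%SET|.
Proof.
move=> hI; rewrite /count_subsets set_of_finset.
set E := [set S | _]%SET; pose f (S : {set T}) := h @` [set` S].
have fI : injective f.
  move=> S S' fS; apply/finset.setP => t; apply/idP/idP => tS.
    have : f S' (h t) by rewrite -fS; exists t.
    by move=> [t' /= t'S /hI <-].
  have : f S (h t) by rewrite fS; exists t.
  by move=> [t' /= t'S /hI <-].
have -> : fset_set (f @` [set` E]) = [fset f S | S in E]%fset.
  apply/fsetP => A; rewrite in_fset_set; last exact/finite_image/finite_finset.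
  apply/idP/imfsetP => [|[S /= SE ->]]; last by rewrite inE; exists S.
  by rewrite inE => -[S /= SE <-]; exists S.
by rewrite card_imfset //= -cardE.
Qed.

Lemma count_avoid B N W P c : finite_set B -> N `<=` B -> W `<=` N ->
  covered N c -> (forall A, P A <-> P (A `\` N)) ->
  count_subsets B [set A | P A /\ A `&` N <> W] * 2 ^ c <=
  count_subsets B P * (2 ^ c).-1.
Proof.
move=> /finite_range[T [h [hI <-]]] NB WN Nc PN.
rewrite !count_subsets_card //.
pose N' := [set t | `[< N (h t) >]]%SET; pose W' := [set t | `[< W (h t) >]]%SET.
have N'E t : (t \in N') = `[< N (h t) >] by rewrite inE.
have W'E t : (t \in W') = `[< W (h t) >] by rewrite inE.
have /(card_avoid) : W' \subset N'.
  by apply/fintype.subsetP => t; rewrite N'E W'E => /asboolP/WN/asboolP.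
move=> /(_ (fun S => `[< P (h @` [set` S]) >]) c) avoid.
apply: leq_trans (avoid _ _).
- rewrite leq_mul2r; apply/orP; right; apply/subset_leq_card/fintype.subsetP => S.
  rewrite finset.in_set => /asboolP[PS SN]; rewrite finset.in_set.
  apply/andP; split; first exact/asboolP.
  apply/eqP => SN'; apply: SN; apply/seteqP; split=> [_ [[t /= tS <-]] Nt|x Wx].
    apply/asboolP; rewrite -W'E -SN' finset.in_setI tS N'E; exact/asboolP.
  have Nx := WN _ Wx; split=> //; have [t _ tx] := NB _ Nx.
  exists t => //=; have : t \in W' by rewrite W'E tx; apply/asboolP.
  by rewrite -SN' finset.in_setI => /andP[].
- have [l lc Nl] := covered_preimage hI Nc; apply: leq_trans lc.
  rewrite cardE; apply: uniq_leq_size (enum_uniq _) _ => t.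
  by rewrite mem_enum N'E => /asboolP Nt; apply: In_mem; exact: Nl.
- move=> S; apply/asbool_equiv_eq; rewrite PN.
  suff -> : h @` [set` (S :\: N')%SET] = h @` [set` S] `\` N by [].
  apply/seteqP; split=> [_ [t /= tS <-]|_ [[t /= tS <-] Nt]].
    move: tS; rewrite finset.in_setD N'E => /andP[/asboolP Nt tS].
    by split=> //; exists t.
  by exists t => //=; rewrite finset.in_setD N'E tS andbT; apply/asboolP.
Qed.

Lemma count_subsets_le B P Q : finite_set B ->
  (forall A, A `<=` B -> P A -> Q A) -> count_subsets B P <= count_subsets B Q.
Proof.
move=> Bfin PQ; apply: fsubset_leq_card.
rewrite -fset_set_sub; try exact: finite_subsets.
by move=> A [AB PA]; split=> //; exact: PQ.
Qed.

Lemma count_subsetsC B P : finite_set B ->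
  count_subsets B P + count_subsets B (~` P) = count_subsets B setT.
Proof.
move=> /finite_range[T [h [hI <-]]]; rewrite !count_subsets_card //.
set E := [set S | `[< P _ >]]%SET.
have -> : [set S : {set T} | `[< (~` P) (h @` [set` S]) >]]%SET = finset.setC E.
  by apply/finset.setP => S; rewrite !inE asbool_neg.
rewrite cardsC -cardsT; apply: eq_card => S; rewrite !inE.
by apply/esym/asboolP.
Qed.

Lemma count_subsets_gt0 B : finite_set B -> 0 < count_subsets B setT.
Proof.
move=> /finite_range[T [h [hI <-]]]; rewrite count_subsets_card //.
by rewrite card_gt0; apply/set0Pn; exists finset.set0; rewrite inE; apply/asboolP.
Qed.

End Counting.

(** * Isolated copies in random substructures *)

Section RandomSubstructures.
Variable V : vocabulary.
Implicit Types W X Y : structure V.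

Definition has_isolated W X := exists f : W -> X, isolated_embedding f.

(** An edge of the substructure on [A] is also an edge of [X]. Starting in the copy, it ends in [A]
    and in the neighborhood of the copy, hence in the copy. *)
Lemma isolated_of_trace W X (A : set X) (f : W -> X) : injective f -> strong_hom f ->
  A `&` nbhd (range f) = range f -> has_isolated W (substructure A).
Proof.
move=> fI fP Af.
have fA w : f w \in A.
  by rewrite inE; have : range f (f w) by [exists w]; rewrite -Af => -[].
exists (fun w => exist _ (f w) (fA w)); split=> [w w' /(congr1 val)/fI//|//|w u wu].
have [v _ vu] : range f (val u).
  rewrite -Af; split; first exact: set_mem (valP u).
  right; exists (f w); first by exists w.
  exact: (@strong_hom_edge V (substructure A) X val _ _ val_inj (@strong_hom_val _ _ A) wu).
by exists v; apply: val_inj.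
Qed.

(* The [m] copies of [W] found in [X] have pairwise disjoint neighborhoods, so
   the events that a random set meets these neighborhoods in exactly the
   copies are independent; each has probability at least [2 ^ - (c * D.+1)]. The
   event [P] that none of them happens depends only on the union [G] of the
   neighborhoods, which is what makes the induction on [m] work. *)
Lemma few_without_isolated W X D c m : locally_bounded X D ->
  (forall k (F : set X), covered F k ->
    exists f : W -> X, [/\ injective f, strong_hom f & forall w, ~ F (f w)]) ->
  covered [set: W] c ->
  exists k (G : set X) (P : set (set X)),
    [/\ covered G k,
        forall A A', A `&` G = A' `&` G -> P A -> P A',
        forall A, ~ has_isolated W (substructure A) -> P A &
        forall B, finite_set B -> G `<=` B ->
          count_subsets B P * (2 ^ (c * D.+1)) ^ m <=
          count_subsets B setT * (2 ^ (c * D.+1)).-1 ^ m].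
Proof.
move=> XD Wcopies Wc; elim: m => [|m [k [G [P [Gk PG PW Pm]]]]].
  by exists 0, set0, setT; split=> //; exists [::].
(* The copy avoids the neighborhood of [G], not just [G], so that its own neighborhood [N] is
   disjoint from [G]. *)
have [f [fI fP fG]] := Wcopies _ _ (covered_nbhd XD Gk).
pose N := nbhd (range f).
have fN : range f `<=` N by left.
have Nc : covered N (c * D.+1).
  by apply: covered_nbhd => //; exact: covered_image.
have NG x : N x -> ~ G x.
  move=> [[w _ <-]|[_ [w _ <-] wx]] Gx; apply: (fG w); first by left.
  by right; exists x => //; exact: edge_sym.
exists (k + c * D.+1), (G `|` N), [set A | P A /\ A `&` N <> range f].
split; first exact: coveredU.
- move=> A A' AA' [PA Af]; split.
    apply: PG PA; have := congr1 (setI^~ G) AA'.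
    by rewrite -!setIA !(setIidr (@subsetUl _ G N)).
  move=> A'f; apply: Af; rewrite -A'f; have := congr1 (setI^~ N) AA'.
  by rewrite -!setIA !(setIidr (@subsetUr _ G N)).
- move=> A Ano; split; first exact: PW.
  by move=> Af; apply: Ano; exact: isolated_of_trace Af.
- move=> B Bfin GNB.
  have NB : N `<=` B by move=> x Nx; apply: GNB; right.
  have GB : G `<=` B by move=> x Nx; apply: GNB; left.
  have PN A : P A <-> P (A `\` N).
    have AN : A `&` G = (A `\` N) `&` G.
      apply/seteqP; split=> [x [Ax Gx]|x [[Ax Nx] Gx]]; split=> //.
      by split=> // /NG.
    by split; exact: PG.
  rewrite !expnS mulnA.
  apply: (@leq_trans (count_subsets B P * (2 ^ (c * D.+1)).-1 * (2 ^ (c * D.+1)) ^ m)).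
    by rewrite leq_mul2r count_avoid ?orbT.
  by rewrite mulnAC [X in _ <= X]mulnCA mulnC leq_mul2l Pm ?orbT.
Qed.

Lemma walk_thicken X (x : X) n y : has_walk x y n -> thicken n [set x] y.
Proof.
move=> [p [xp <- <-]] {y n}; elim/last_ind: p xp => //= p y IH.
rewrite rcons_path last_rcons size_rcons => /andP[/IH xp /asboolP py].
by right; exists (last x p).
Qed.

Lemma connected_walk X (x y : X) : connected_structure X -> exists n, has_walk x y n.
Proof.
move=> [K [_ Kuniq]]; have Ky : component x = component y.
  by apply: etrans (esym (Kuniq _ _)) (Kuniq _ _); [exists x|exists y].
have : component y y by exists 0, [::].
by rewrite -Ky.
Qed.

Lemma ball_walk X (x y : X) n m : has_walk x y m -> m <= n -> gaifman_ball n x y.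
Proof.
move=> xy mn.
have exm : exists k, `[< has_walk x y k >] by exists m; apply/asboolP.
case: (ex_minnP exm) => d /asboolP xd dmin; exists d.
  by split=> // k xk; apply: dmin; apply/asboolP.
by apply: leq_trans mn; apply: dmin; apply/asboolP.
Qed.

Lemma ball_finite X D n (x : X) : locally_bounded X D -> finite_set (gaifman_ball n x).
Proof.
move=> XD; apply: sub_finite_set (covered_finite (covered_thicken n XD (covered1 x))).
by move=> y [d [xy _] dn]; apply: thicken_le dn _ (walk_thicken xy).
Qed.

Lemma ball_covers X (x : X) (G : set X) k : connected_structure X -> covered G k ->
  exists n0, forall n, n0 <= n -> G `<=` gaifman_ball n x.
Proof.
move=> Xconn [l _ Gl].
suff [n0 ln] : exists n0, forall y, List.In y l -> gaifman_ball n0 x y.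
  exists n0 => n n0n y /Gl/ln[d xd dn]; exists d => //; exact: leq_trans n0n.
elim: l {Gl} => [|y l [n0 ln]]; first by exists 0.
have [d xd] := connected_walk x y Xconn.
exists (maxn d n0) => z [<-|/ln[e xe en]]; first by apply: ball_walk xd (leq_maxl _ _).
by exists e => //; apply: leq_trans en (leq_maxr _ _).
Qed.

Local Open Scope ring_scope.

(** [Q] is arbitrary because this serves for a sentence and for its negation. With
    [q = 1 - 2 ^ - (c * D.+1)], the failures have fraction at most [q ^ m] once the ball contains
    the [m] chosen neighborhoods. *)
Lemma isolated_almost_surely (R : realType) W X D c (Q : set (set X)) (x : X) :
  connected_structure X -> locally_bounded X D ->
  (forall k (F : set X), covered F k ->
    exists f : W -> X, [/\ injective f, strong_hom f & forall w, ~ F (f w)]) ->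
  covered [set: W] c ->
  (forall A, finite_set A -> has_isolated W (substructure A) -> Q A) ->
  (count_subsets (gaifman_ball n x) Q)%:R /
  (count_subsets (gaifman_ball n x) setT)%:R @[n --> \oo] --> (1 : R).
Proof.
move=> Xconn XD Wcopies Wc WQ.
set K := (2 ^ (c * D.+1))%N; pose q : R := K.-1%:R / K%:R.
have K0 : (0 < K)%N by rewrite expn_gt0.
have q0 : 0 <= q by rewrite divr_ge0 ?ler0n.
have q1 : `|q| < 1.
  by rewrite ger0_norm // ltr_pdivrMr ?ltr0n // mul1r ltr_nat prednK.
apply/cvgrPdist_lt => e e0.
have /cvgrPdist_lt/(_ e e0)[m _ /(_ m (leqnn m))] := cvg_expr q1.
rewrite sub0r normrN ger0_norm ?exprn_ge0 // => qm.
have [k [G [P [Gk _ PW Pm]]]] := few_without_isolated m XD Wcopies Wc.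
have [n0 Gn] := ball_covers x Xconn Gk.
exists n0 => // n /= n0n; set B := gaifman_ball n x.
have Bfin : finite_set B := ball_finite n x XD.
have T0 : (0 : R) < (count_subsets B setT)%:R.
  by rewrite ltr0n; exact: count_subsets_gt0.
have -> : 1 - (count_subsets B Q)%:R / (count_subsets B setT)%:R =
    (count_subsets B (~` Q))%:R / (count_subsets B setT)%:R :> R.
  rewrite -[X in X - _](divff (lt0r_neq0 T0)) -mulrBl.
  by rewrite -[X in (X%:R - _) / _](count_subsetsC Q Bfin) natrD addrC addKr.
rewrite ger0_norm ?divr_ge0 ?ler0n //; apply: le_lt_trans qm.
rewrite ler_pdivrMr // expr_div_n -!natrX mulrAC.
rewrite ler_pdivlMr ?ltr0n ?expn_gt0 ?K0 //.
rewrite -!natrM ler_nat [X in (_ <= X)%N]mulnC.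
apply: leq_trans (Pm B Bfin (Gn n n0n)).
rewrite leq_mul2r; apply/orP; right; apply: count_subsets_le => // A AB QA.
by apply: PW => WA; apply: QA; apply: WQ => //; exact: sub_finite_set AB _.
Qed.

End RandomSubstructures.
(** * Ambient structures *)

Section Ambient.
Variable V : vocabulary.
Implicit Types W X Y Z : structure V.

(** The induced substructure on [x] and [y] alone may lose their edge, whose tuple can use other
    points; [E] collects the entries of such a tuple. *)
Lemma edge_finite_support X (x y : X) : edge x y ->
  exists2 E : set X, finite_set E & forall (A : set X) (u v : substructure A),
    E `<=` A -> val u = x -> val v = y -> edge u v.
Proof.
move=> [xy [R [z [Rz [i zi] [j zj]]]]]; exists (range z).
  exact/finite_image/finite_finset.
move=> A u v zA ux vy; split=> [uv|]; first by apply: xy; rewrite -ux -vy uv.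
have zA' k : z k \in A by rewrite inE; apply: zA; exists k.
exists R, (fun k => exist _ (z k) (zA' k)); split=> //.
- by exists i; apply: val_inj; rewrite ux.
- by exists j; apply: val_inj; rewrite vy.
Qed.

(** Any finite set of neighbors of [x], together with the tuples behind their edges, fits in a
    finite substructure, so it has at most [D] elements. *)
Lemma degree_of_finite_substructures X D :
  (forall A : set X, finite_set A -> degree_bounded_by (substructure A) D) ->
  degree_bounded_by X D.
Proof.
move=> AD x; set N := [set y | edge x y].
have small (T : set X) : finite_set T -> T `<=` N -> (T #<= `I_D)%card.
  move=> Tfin TN.
  have /choice[E EP] : forall y, exists E : set X, finite_set E /\ (T y ->
      forall (A : set X) (u v : substructure A),
        E `<=` A -> val u = x -> val v = y -> edge u v).
    move=> y; have [Ty|nTy] := pselect (T y); last by exists set0; split.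
    by have [E Efin EA] := edge_finite_support (TN y Ty); exists E.
  pose A := (x |` T) `|` \bigcup_(y in T) E y.
  have Afin : finite_set A.
    rewrite !finite_setU; split; first by split=> //; exact: finite_set1.
    by apply: bigcup_finite => // y _; case: (EP y).
  have xA : x \in A by rewrite inE; left; left.
  pose u : substructure A := exist _ x xA.
  apply: card_le_trans (AD A Afin u).
  apply: card_le_trans (card_image_le val _); apply: subset_card_le => y Ty.
  have yA : y \in A by rewrite inE; left; right.
  exists (exist _ y yA) => //=; have [_ Ey] := EP y.
  by apply: (Ey Ty A) => // z Ez; right; exists y.
(* An infinite set of neighbors would contain a finite subset with more than [D] elements. *)
have [Nfin|Ninf] := pselect (finite_set N); first exact: small.
have [B BN DB] := @infinite_set_fset {classic X} N D.+1 Ninf.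
have /(@geq_card_fset_set {classic X}) := small _ (finite_fset B) BN.
by rewrite set_fsetK leqNgt DB.
Qed.

Lemma strong_hom_walk X Y (f : X -> Y) x y n :
  injective f -> strong_hom f -> has_walk x y n -> has_walk (f x) (f y) n.
Proof.
move=> fI fP [p [xp <- <-]]; exists (map f p); split.
- rewrite path_map; apply: sub_path xp => a b /asboolP ab; apply/asboolP.
  exact: strong_hom_edge.
- exact: last_map.
- exact: size_map.
Qed.

Lemma walk_connected X : (exists x : X, True) ->
  (forall x y : X, exists n, has_walk x y n) -> connected_structure X.
Proof.
move=> [x0 _] Xw; have compT (x : X) : component x = setT.
  by apply/seteqP; split=> // y _; exact: Xw.
by exists setT; split=> [|K [x ->]]; [exists x0|].
Qed.

(* Compatible injections into [nat] make the limit a subset of [nat], so that no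
   quotient is needed. *)
Section DirectedUnion.
Variables (Z : nat -> structure V) (g : forall k, Z k -> nat).
Hypothesis gI : forall k, injective (@g k).
Hypothesis Z_step :
  forall k, exists2 f : Z k -> Z k.+1, strong_hom f & forall z, g (f z) = g z.

Lemma chain_embedding k l : k <= l ->
  exists2 f : Z k -> Z l, strong_hom f & forall z, g (f z) = g z.
Proof.
move=> /subnK <-; elim: (l - k) => [|d [f fP gf]]; first by exists id.
have [h hP gh] := Z_step (d + k).
by exists (h \o f) => [|z]; [exact: strong_hom_comp|rewrite /= gh].
Qed.

Definition union_carrier := {n : nat | exists k (z : Z k), g z = n}.

Definition chain_union : structure V :=
  Structure (carrier := union_carrier) (fun R x =>
    exists k (w : 'I_(arity R) -> Z k), interp (Z k) R w /\
      forall i, g (w i) = sval (x i)).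

Definition chain_inj k (z : Z k) : chain_union :=
  exist _ (g z) (ex_intro _ k (ex_intro _ z erefl)).

Lemma chain_inj_eq k l (z : Z k) (w : Z l) :
  g z = g w -> chain_inj z = chain_inj w.
Proof. by move=> zw; apply: eq_exist. Qed.

Lemma chain_inj_injective k : injective (@chain_inj k).
Proof. by move=> x y /(congr1 sval)/gI. Qed.

(** Any two stages agree on truth, as the transition maps also reflect relations; the case split
    decides which stage embeds in the other. *)
Lemma chain_inj_strong_hom k : strong_hom (@chain_inj k).
Proof.
move=> R z; split=> [Rz|[l [w [Rw wz]]]]; first by exists k, z.
have [kl|/ltnW lk] := leqP k l.
  have [f fP gf] := chain_embedding kl; apply/(fP R).
  suff -> : f \o z = w by [].
  by apply/funext => i; apply: gI; rewrite /= gf wz.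
have [f fP gf] := chain_embedding lk.
suff -> : z = f \o w by apply/(fP R).
by apply/funext => i; apply: gI; rewrite /= gf wz.
Qed.

Lemma chain_inj_cover (A : set chain_union) : finite_set A ->
  exists k, A `<=` range (@chain_inj k).
Proof.
move=> /finite_covered[_ [l _ Al]].
suff [k kl] : exists k, forall x, List.In x l -> range (@chain_inj k) x.
  by exists k => x /Al /kl.
elim: l {Al} => [|[n [j [z zn]]] l [k kl]]; first by exists 0.
have lift i (m : nat) : i <= m -> range (@chain_inj i) `<=` range (@chain_inj m).
  move=> im _ [y _ <-]; have [f _ gf] := chain_embedding im.
  by exists (f y) => //; apply: chain_inj_eq.
exists (maxn j k) => x [<-|/kl]; last exact: lift (leq_maxr _ _) _.
by apply: (lift j) (leq_maxl _ _) _ _; exists z => //; apply: eq_exist.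
Qed.

End DirectedUnion.

Variable C : structure V -> Prop.
Hypotheses (C_nonempty : exists Y, C Y) (C_finite : finite_members C)
  (C_iso : iso_closed C) (C_pseudo_connected : pseudo_connected C)
  (C_sub : substructure_closed C) (C_union : disjoint_union_closed C).

(** [X] contains a union of [k + 1] copies of [W], one of which misses [F]. The copy is induced but
    need not be isolated in [X]. *)
Lemma embeds_avoiding X W k (F : set X) :
  (forall Y, C Y -> embeds Y X) -> C W -> covered F k ->
  exists f : W -> X, [/\ injective f, strong_hom f & forall w, ~ F (f w)].
Proof.
move=> CX CW Fk; have [U CU UF] := disjoint_copies C_union k CW.
have [h hI hP] := CX U CU.
have [e [eI eP _] eF] := UF _ (covered_preimage hI Fk).
exists (h \o e); split=> //; [exact: inj_comp|exact: strong_hom_comp].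
Qed.

(** The empty structure has no component, so a connected member has a point. *)
Lemma pointed_member : exists2 Y, C Y & exists y : Y, True.
Proof.
have [Y0 CY0] := C_nonempty.
have [Z [CZ [_ [[z _] _]] _]] := C_pseudo_connected CY0.
by exists Z => //; exists z.
Qed.

Lemma ambient_of_substructures X D : degree_bounded_by X D ->
  connected_structure X -> (forall Y, C Y -> embeds Y X) ->
  (forall A : set X, finite_set A -> C (substructure A)) -> ambient C X.
Proof.
move=> XD Xconn CX XC; have Xlb := degree_locally_bounded XD; split=> //.
(* If [X] were finite, a nonempty member could be placed off all of [X]. *)
- move=> /finite_covered[k Xk]; have [Y CY [y _]] := pointed_member.
  by have [f [_ _ /(_ y)[]]] := embeds_avoiding CX CY Xk.
- by exists D.
(* The duplicate is a copy of [A] that avoids the whole neighborhood of [A], so that no edge joins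
   the two. *)
- move=> A Afin; have [k Ak] := finite_covered Afin.
  have [f [fI fP fA]] := embeds_avoiding CX (XC A Afin) (covered_nbhd Xlb Ak).
  exists (range f); first exact: embedding_isomorphic fI fP erefl.
  split; last first.
    by move=> a _ Aa [w _ <-] aw; apply: (fA w); right; exists a.
  by apply/seteqP; split=> // x [Ax [w _ fw]]; apply: (fA w); left; rewrite fw.
- move=> Y; split=> [CY|[A Afin YA]].
    have [f fI fP] := CX Y CY; exists (range f).
      exact: finite_image (C_finite CY).
    exact: embedding_isomorphic fI fP erefl.
  exact: C_iso (isomorphic_sym YA) (XC A Afin).
Qed.

Lemma C_enumeration : exists e : nat -> structure V,
  (forall n, C (e n)) /\ forall Y, C Y -> exists n, isomorphic Y (e n).
Proof.
have [Y0 CY0] := C_nonempty.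
(* [Y0] is the default value for numbers that code no member of [C]. *)
pose e n := if (choice.unpickle n : option {m : nat & fin_code V m}) is Some c
  then if `[< C (fin_decode c) >] then fin_decode c else Y0 else Y0.
exists e; rewrite /e; split=> [n|Y CY].
  by case: choice.unpickle => // c; case: asboolP.
have [k Yk] := finite_covered (C_finite CY).
have [c _ Yc] := fin_decode_surj Yk.
exists (choice.pickle c); rewrite choice.pickleK; case: asboolP => // -[].
exact: C_iso Yc CY.
Qed.

(** The labels become the elements of the limit; the bound [N] leaves fresh labels for later
    stages. *)
Definition stage (s : {Z : structure V & Z -> nat}) :=
  [/\ C (tag s), connected_structure (tag s), injective (tagged s) &
      exists N, forall z, tagged s z < N].

Lemma stage_of_member Y : C Y -> exists s, stage s /\ embeds Y (tag s).
Proof.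
move=> /C_pseudo_connected[Z [CZ Zconn YZ]].
have /finite_set_leP[N /pcard_leP[r]] := C_finite CZ.
exists (existT (fun Z : structure V => Z -> nat) Z r); split=> //; split=> //=.
by exists N => z; exact: (@funS _ _ _ _ r z I).
Qed.

(** Pseudo-connectedness is applied to the disjoint union of the current stage and [Y]. *)
Lemma stage_step s Y : stage s -> C Y -> exists t, [/\ stage t, embeds Y (tag t) &
  exists2 f : tag s -> tag t, strong_hom f & forall z, tagged t (f z) = tagged s z].
Proof.
case: s => Z g [/= CZ Zconn gI [N gN]] CY.
pose F b := if b then Z else Y.
have [t [[Ct tconn rI [K rK]] [h hI hP]]] := stage_of_member (C_union CZ CY).
case: t Ct tconn rI rK h hI hP => T r /= CT Tconn rI rK h hI hP.
have [ZI ZP _] := isolated_union_inj F true.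
have [YI YP _] := isolated_union_inj F false.
pose f (z : Z) : T := h (existT F true z).
have fI : injective f := inj_comp hI ZI.
have fP : strong_hom f := strong_hom_comp ZP hP.
(* Old points keep their labels, which are below [N]; new ones are labelled from [N] on. *)
have /choice[q qP] : forall x : T, exists n,
    (exists2 z, f z = x & n = g z) \/ (~ range f x /\ n = N + r x).
  move=> x; have [[z _ zx]|nx] := pselect (range f x).
    by exists (g z); left; exists z.
  by exists (N + r x); right.
have qf z : q (f z) = g z.
  by have [[z' /fI -> //]|[[]]] := qP (f z); exists z.
exists (existT (fun Z : structure V => Z -> nat) T q); split=> /=.
- split=> //=.
    move=> x y; have [[z <- ->]|[_ ->]] := qP x; have [[z' <- ->]|[_ ->]] := qP y.
    + by move=> /gI ->.
    + by move=> gN'; have := gN z; rewrite gN' ltnNge leq_addr.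
    + by move=> gN'; have := gN z'; rewrite -gN' ltnNge leq_addr.
    + by move=> /addnI/rI.
  exists (N + K) => x; have [[z _ ->]|[_ ->]] := qP x.
    exact: leq_trans (gN z) (leq_addr _ _).
  by rewrite ltn_add2l.
- exists (fun y : Y => h (existT F false y)).
    exact: (inj_comp hI YI).
  exact: (strong_hom_comp YP hP).
- by exists f.
Qed.

Lemma ambient_exists : class_bounded_degree C -> exists X, ambient C X.
Proof.
move=> [D CD]; have [e [Ce eC]] := C_enumeration.
have [s0 [s0P _]] : exists s, stage s /\ embeds (e 0) (tag s).
  exact: stage_of_member.
pose S := {s | stage s}.
(* The index is passed along so that step [n] absorbs the enumerated member [e n]. *)
have /choice[next nextP] : forall p : S * nat, exists t : S,
    embeds (e p.2) (tag (sval t)) /\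
    exists2 f : tag (sval p.1) -> tag (sval t), strong_hom f &
      forall z, tagged (sval t) (f z) = tagged (sval p.1) z.
  move=> [[s sP] n]; have [t [tP et st]] := stage_step sP (Ce n).
  by exists (exist _ t tP).
pose s := fix s n : S := if n is m.+1 then next (s m, m) else exist _ s0 s0P.
pose Z n : structure V := tag (sval (s n)).
pose g n : Z n -> nat := tagged (sval (s n)).
have sP n : stage (existT (fun Z : structure V => Z -> nat) (Z n) (g n)).
  by rewrite /g /Z; case: (s n) => [[]].
have gI n : injective (g n) by have [] := sP n.
have Zstep n : exists2 f : Z n -> Z n.+1, strong_hom f & forall z, g _ (f z) = g _ z.
  by have [] := nextP (s n, n).
have XI := chain_inj_injective gI; have XP := chain_inj_strong_hom gI Zstep.
have Xcover := chain_inj_cover Zstep.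
set X := chain_union g in XI XP Xcover.
have XC (A : set X) : finite_set A -> C (substructure A).
  move=> /Xcover[k Ak]; apply: C_iso (preimage_substructure (XI k) (XP k) Ak) _.
  by apply: C_sub; have [] := sP k.
exists X; apply: (@ambient_of_substructures _ D) => //.
- by apply: degree_of_finite_substructures => A Afin; apply: CD; exact: XC.
- apply: walk_connected.
    have [_ [_ [[z _] _]] _ _] := sP 0.
    by exists (@chain_inj _ g 0 z).
  move=> x y; have [k xyk] := Xcover _ (finite_set2 x y).
  have [a _ <-] : range (@chain_inj _ g k) x by apply: xyk; left.
  have [b _ <-] : range (@chain_inj _ g k) y by apply: xyk; right.
  have [_ Zconn _ _] := sP k; have [n ab] := connected_walk a b Zconn.
  by exists n; exact: strong_hom_walk.
- move=> Y CY; have [n Yn] := eC Y CY.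
  have [f [fI fP _]] := isomorphic_isolated Yn.
  have [[h hI hP] _] := nextP (s n, n).
  exists (fun y => @chain_inj _ g n.+1 (h (f y))).
    exact: (inj_comp (XI n.+1) (inj_comp hI fI)).
  exact: (strong_hom_comp (strong_hom_comp fP hP) (XP n.+1)).
Qed.

End Ambient.

Theorem theorem5 (R : realType) (V : vocabulary) (C : structure V -> Prop)
    (C_nonempty : exists Y, C Y)
    (C_finite : finite_members C)
    (C_iso : iso_closed C)
    (C_pseudo_connected : pseudo_connected C)
    (C_degree : class_bounded_degree C)
    (C_sub : substructure_closed C)
    (C_union : disjoint_union_closed C)
    (I : Type) (rep : I -> structure V) (C_rep : representatives C rep) :
  (exists X : structure V, ambient C X) /\
  (forall (X : structure V) (phi : sentence V), ambient C X ->
    (almost_surely_true R X phi <-> models (disjoint_union rep) phi)).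
Proof.
split; first exact: ambient_exists.
move=> X phi [_ Xconn [D' XD'] _ XC]; have [D CD] := C_degree.
have [K KP] := rich_models C D phi.
have [W CW WK] := rich_witness C_nonempty C_iso C_union K.
have Slocal := union_locally_in C_iso CD C_sub C_rep.
have Srich : rich C K (disjoint_union rep).
  exact: (union_rich C_nonempty C_iso C_union C_rep).
have [c Wc] := finite_covered (C_finite _ CW).
(* The substructure on [A] is a member of [C], made rich by its copy of [W]; the disjoint union is
   rich as well, so [phi] cannot separate them. *)
have agree (A : set X) : finite_set A -> has_isolated W (substructure A) ->
    models (substructure A) phi <-> models (disjoint_union rep) phi.
  move=> Afin [h hi]; apply: KP => //; last exact: WK hi.
  apply: (locally_in_member CD C_sub); apply/XC; exists A => //.
  by exists id => //; exists id.
have Wcopies k (F : set X) : covered F k ->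
    exists f : W -> X, [/\ injective f, strong_hom f & forall w, ~ F (f w)].
  apply: (embeds_avoiding C_union) => // Y /XC[A _ /isomorphic_isolated[f [fI fP _]]].
  by exists (val \o f); [exact: inj_comp val_inj fI|exact: strong_hom_comp fP (@strong_hom_val _ _ A)].
have Xlb := degree_locally_bounded XD'.
have as1 Q x := isolated_almost_surely (R := R) (Q := Q) x Xconn Xlb Wcopies Wc.
have fractionE x n : fraction_true R phi x n =
    ((count_subsets (gaifman_ball n x) [set A | models (substructure A) phi])%:R /
     (count_subsets (gaifman_ball n x) setT)%:R)%R.
  congr (_ / (#|` fset_set _|)%:R)%R.
  by apply/seteqP; split=> A // [].
split=> [asphi|Sphi x]; last first.
  under eq_fun do rewrite fractionE.
  by apply: as1 => A Afin WA; apply/agree.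
have [x _] : exists x : X, True by case: Xconn => _ [[x _] _]; exists x.
apply: contrapT => nSphi.
have nas := as1 (~` [set A | models (substructure A) phi]) x.
have {}nas := nas (fun A Afin WA mA => nSphi ((agree A Afin WA).1 mA)).
(* If [phi] failed in the disjoint union, its negation would also be almost surely true; the two
   fractions sum to 1, yet their sum would tend to 2. *)
have : (fun=> 1 : R)%R @ \oo --> (1 + 1 : R)%R.
  apply: cvg_trans (cvgD (asphi x) nas); apply: near_eq_cvg; near=> n => /=.
  have Bfin := ball_finite n x Xlb.
  rewrite fctE fractionE -mulrDl -natrD count_subsetsC // divff // pnatr_eq0 -lt0n.
  exact: count_subsets_gt0.
move=> /(cvg_unique (@norm_hausdorff _ R) (cvg_cst (1 : R)%R)) /eqP.
by rewrite -subr_eq0 opprD addNKr oppr_eq0 oner_eq0.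
Unshelve. all: by end_near.
Qed.
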